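(* Let $W$ be a finite Weyl group with simple reflections $S$, associated to a crystallographic root system $\Phi$, let $w\in W$, and let $J\subset S$. Then $w=w^Jw_J$ is a Billey--Postnikov decomposition (i.e. $J\in\mathsf{BP}(w)$) if and only if $w$ avoids all $J$-star patterns, i.e. $w$ contains no $J$-star.
   Context: $\Phi$ is a finite crystallographic root system with positive roots $\Phi^+$, simple roots $\Delta$, Weyl group $W$, and simple reflections $S=\{s_\alpha\mid\alpha\in\Delta\}$. For $J\subset S$: $\Delta_J\subset\Delta$ is the corresponding set of simple roots, $\Phi_J^+\subset\Phi^+$ is the set of positive roots that are linear combinations of $\Delta_J$, $W_J$ is the parabolic subgroup generated by $J$, and $W^J$ is the set of minimal-length representatives of the cosets $W/W_J$. Each $w\in W$ factors uniquely as $w=w^Jw_J$ with $w^J\in W^J$, $w_J\in W_J$. Write $\operatorname{Supp}(w)=\{s\in S\mid s\le w \text{ in Bruhat order}\}$ and $D_L(w)=\{s\in S\mid \ell(sw)<\ell(w)\}$. The decomposition $w=w^Jw_J$ is a Billey--Postnikov (BP) decomposition if $\operatorname{Supp}(w^J)\cap J\subset D_L(w_J)$; $\mathsf{BP}(w)$ is the set of $J\subset S$ for which this holds. The (right) inversion set of $w$ is $I(w)=\{\beta\in\Phi^+\mid w\beta\in\Phi\setminus\Phi^+\}$. A tuple $(\beta,c_1\gamma_1,\ldots,c_k\gamma_k)$ with $k\ge 1$ forms a $J$-star if $\beta\in\Phi_J^+$, $\gamma_1,\ldots,\gamma_k\in\Phi^+\setminus\Phi_J^+$, and $c_1,\ldots,c_k$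 are positive integers such that $\beta+\sum_{i\in I}c_i\gamma_i\in\Phi^+$ for all $I\subset\{1,\ldots,k\}$. The element $w$ contains this $J$-star if $\beta\notin I(w)$ and $\beta+\sum_{i=1}^kc_i\gamma_i\in I(w)$. *)

(* Defs.v *)
From Stdlib Require Import Relations.
From HB Require Import structures.
From mathcomp Require Import all_boot all_order all_algebra.
From mathcomp Require Import boolp.

Set Implicit Arguments.
Unset Strict Implicit.
Unset Printing Implicit Defensive.

Import Order.TTheory GRing.Theory Num.Theory.
Local Open Scope ring_scope.

(* The ambient Euclidean space is a finite-dimensional V over an ordered field
   with a symmetric positive definite form; W acts on V on the left, and the
   product u v of W is the composition (u \o v)%VF, which applies v first. *)

Section Reflections.

Variables (R : realFieldType) (V : vectType R) (form : {dot V for idfun}).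

Definition cartan (b a : V) : R := 2 * form b a / form a a.

Definition reflection (a v : V) : V := v - cartan v a *: a.

Fact reflection_is_linear (a : V) : linear (reflection a).
Proof.
move=> k u v; rewrite /reflection /cartan linearPl /= mulrDr mulrDl.
rewrite scalerDl opprD scalerBr scalerA mulrCA -mulrA -mulrA addrACA.
by rewrite -!mulrA.
Qed.

HB.instance Definition _ (a : V) :=
  GRing.isLinear.Build R V V *:%R (reflection a) (reflection_is_linear a).

Definition refl (a : V) : 'End(V) := linfun (reflection a).

Lemma reflE (a v : V) : refl a v = v - cartan v a *: a.
Proof. by rewrite /refl lfunE. Qed.

Definition refl_prod (s : seq V) : 'End(V) :=
  foldr (fun a f => (refl a \o f)%VF) \1%VF s.

(* Reflections are involutions, so their products already form the group that
   they generate. *)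
Definition refl_group (A : {pred V}) (w : 'End(V)) : Prop :=
  exists2 s : seq V, {subset s <= A} & w = refl_prod s.

(* Phi need not span V, as for type A_n inside R^(n+1). *)
Record is_root_system (Phi : seq V) : Prop := IsRootSystem {
  root_neq0 : forall a, a \in Phi -> a != 0;
  root_reduced : forall (a : V) (k : R),
    a \in Phi -> k *: a \in Phi -> k = 1 \/ k = -1;
  root_refl : forall a b, a \in Phi -> b \in Phi -> refl a b \in Phi;
  root_cartan : forall a b, a \in Phi -> b \in Phi ->
    exists z : int, cartan b a = z%:~R }.

End Reflections.

Section WeylGroup.

Variables (R : realFieldType) (V : vectType R) (form : {dot V for idfun}).
Variables (Phi : seq V) (r : nat) (Delta : r.-tuple V).

Definition pos_root (b : V) : Prop :=
  b \in Phi /\ exists c : 'I_r -> nat, b = \sum_(i < r) tnth Delta i *+ c i.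

Record is_base : Prop := IsBase {
  base_free : free Delta;
  base_sub : {subset Delta <= Phi};
  base_pos_neg : forall b, b \in Phi -> pos_root b \/ pos_root (- b) }.

Definition weyl : 'End(V) -> Prop := refl_group form (mem Phi).

(* Subsets of S are given as sets of indices of simple roots. *)
Definition srefl (i : 'I_r) : 'End(V) := refl form (tnth Delta i).

Definition has_word (w : 'End(V)) (k : nat) : bool :=
  [exists t : k.-tuple 'I_r,
     refl_prod form [seq tnth Delta i | i <- t] == w].

(* The value 0 outside W is never relevant. *)
Definition coxlen (w : 'End(V)) : nat :=
  if pselect (exists k, has_word w k) is left h then ex_minn h else 0%N.

Definition bruhat_step (u w : 'End(V)) : Prop :=
  exists2 b, b \in Phi & w = (u \o refl form b)%VF /\ (coxlen u < coxlen w)%N.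

Definition bruhat_le : 'End(V) -> 'End(V) -> Prop :=
  clos_refl_trans 'End(V) bruhat_step.

Definition in_supp (w : 'End(V)) (i : 'I_r) : Prop := bruhat_le (srefl i) w.

Definition left_descent (w : 'End(V)) : {set 'I_r} :=
  [set i | (coxlen (srefl i \o w)%VF < coxlen w)%N].

Definition inversion (w : 'End(V)) (b : V) : Prop :=
  pos_root b /\ (w b \in Phi /\ ~ pos_root (w b)).

Section Parabolic.

Variable J : {set 'I_r}.

Definition simple_in : seq V := [seq tnth Delta i | i in J].

Definition pos_root_in (b : V) : Prop := pos_root b /\ b \in <<simple_in>>%VS.

Definition parabolic : 'End(V) -> Prop := refl_group form (mem simple_in).

Definition min_coset_rep (v : 'End(V)) : Prop :=
  weyl v /\ forall u, parabolic u -> (coxlen v <= coxlen (v \o u)%VF)%N.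

(* Here v and u stand for w^J and w_J: the factorization exists and is unique
   for every w in W. *)
Definition BP (w : 'End(V)) : Prop :=
  exists v u : 'End(V),
    [/\ min_coset_rep v, parabolic u, w = (v \o u)%VF
      & forall i, in_supp v i -> i \in J -> i \in left_descent u].

Definition star (b : V) (k : nat) (c : 'I_k -> nat) (g : 'I_k -> V) : Prop :=
  [/\ (0 < k)%N,
      pos_root_in b,
      forall i, pos_root (g i) /\ ~ pos_root_in (g i),
      forall i, (0 < c i)%N
    & forall I : {set 'I_k}, pos_root (b + \sum_(i in I) g i *+ c i)].

Definition contains_star (w : 'End(V)) (b : V) (k : nat)
    (c : 'I_k -> nat) (g : 'I_k -> V) : Prop :=
  [/\ star b c g, ~ inversion w b
    & inversion w (b + \sum_(i < k) g i *+ c i)].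

Definition avoids_stars (w : 'End(V)) : Prop :=
  forall (b : V) (k : nat) (c : 'I_k -> nat) (g : 'I_k -> V),
    ~ contains_star w b c g.

End Parabolic.

End WeylGroup.

(* Main.v *)
(* Write w = v u with v = w^J and u = w_J.

   If the decomposition is BP and w contains a star with center b, then u b is a
   positive root of Phi_J. Were it supported on Supp(v), the descents of u would
   make b negative; so some simple root of J outside Supp(v) occurs in u b, and v
   preserves its coefficient in the image of the whole star, which therefore
   stays positive.

   Conversely, let a in J be a simple root in Supp(v) that is not a left descent
   of u, and let K = S \ {s_a}. Since v is not in W_K, it negates a root x of the
   orbit W_K a. Every root x of the same length as a in which a has coefficient 1
   is of the form a - sum_g cartan(a, g) g for pairwise orthogonal roots g of
   Phi_K with (a, g) < 0; all partial sums are images of a under products of the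
   reflections in the g, hence roots. For x of minimal height, v negates every g,
   so g is not in Phi_J: this is a star contained in v, and u^-1 carries it to a
   star contained in w. *)

Require Import Defs.
From mathcomp Require Import all_boot all_order all_algebra.
From mathcomp Require Import boolp lra zify.
From Stdlib Require Import Relations.

Set Implicit Arguments.
Unset Strict Implicit.
Unset Printing Implicit Defensive.

Import Order.TTheory GRing.Theory Num.Theory.
Local Open Scope ring_scope.

(** * Induction along a finite list, and an integer lemma *)

Lemma seq_lt_ind (T : eqType) (R : realDomainType) (f : T -> R) (s : seq T)
    (P : T -> Prop) :
  {in s, forall x, {in s, forall y, f y < f x -> P y} -> P x} -> {in s, forall x, P x}.
Proof.
(* Only finitely many values occur, so the number of entries with a smaller value is a decreasing
   measure although [R] is not well founded. *)
move=> IH x; have [n] := ubnP (count (fun y => f y < f x) s).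
elim: n x => // n IHn x lt_n xs; apply: IH => // y ys lt_yx.
apply: IHn => //; rewrite ltnS in lt_n; apply: leq_trans lt_n.
elim: s ys {xs} => //= z s IHs; rewrite inE => /predU1P[<-|ys].
  rewrite ltxx lt_yx add0n add1n ltnS; apply: sub_count => t /= /lt_trans; exact.
have := IHs ys; case: (ltP (f z) (f y)) => [h|_]; [rewrite (lt_trans h lt_yx)|].
  by rewrite ltn_add2l.
by move=> h; apply: leq_trans h _; rewrite leq_addl.
Qed.

(** The pairs of negative integers with product less than 4 are (-1,-1), (-1,-2), (-1,-3) and their
    swaps; their ratios are pairwise distinct. *)
Lemma neg_int_ratio_inj (m n p q : int) :
  m < 0 -> n < 0 -> p < 0 -> q < 0 -> m * n < 4 -> p * q < 4 -> m * q = p * n -> m = p.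
Proof.
move=> m0 n0 p0 q0 mn pq.
have : m = -1 \/ m = -2 \/ m = -3 by nia.
have : n = -1 \/ n = -2 \/ n = -3 by nia.
have : p = -1 \/ p = -2 \/ p = -3 by nia.
have : q = -1 \/ q = -2 \/ q = -3 by nia.
lia.
Qed.

(** * Reflections *)

Section DotProduct.

Variables (R : realFieldType) (V : vectType R) (form : {dot V for idfun}).
Implicit Types (a x y : V) (g : 'End(V)) (A : {pred V}).

Lemma formC x y : form x y = form y x.
Proof. by rewrite hermC expr0 mul1r. Qed.

Lemma form_gt0 x : x != 0 -> 0 < form x x.
Proof. exact: neq0_dnorm_gt0. Qed.

Lemma form_cartan a x : a != 0 -> 2 * form x a = cartan form x a * form a a.
Proof. by move=> /form_gt0 ?; rewrite /cartan divfK // gt_eqF. Qed.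

Lemma cartan_gt0 a x : a != 0 -> (0 < cartan form x a) = (0 < form x a).
Proof.
by move=> /form_gt0 h; rewrite /cartan pmulr_lgt0 ?invr_gt0 // pmulr_rgt0.
Qed.

Lemma cartan_lt0 a x : a != 0 -> (cartan form x a < 0) = (form x a < 0).
Proof.
by move=> /form_gt0 h; rewrite /cartan pmulr_llt0 ?invr_gt0 // pmulr_rlt0.
Qed.

Lemma cartan_id a : a != 0 -> cartan form a a = 2.
Proof. by move=> /form_gt0 h; rewrite /cartan mulfK // gt_eqF. Qed.

Lemma refl_id a : a != 0 -> refl form a a = - a.
Proof. by move=> a0; rewrite reflE cartan_id // scaler_nat mulr2n opprD addNKr. Qed.

Lemma reflN a : refl form (- a) = refl form a.
Proof.
apply/lfunP => x; rewrite !reflE /cartan linearNr linearNl linearNr opprK.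
by rewrite mulrN mulNr scalerN scaleNr opprK.
Qed.

Definition isometric g := forall x y, form (g x) (g y) = form x y.

Lemma refl_isometric a : a != 0 -> isometric (refl form a).
Proof.
move=> a0 x y; rewrite !reflE linearBl !linearBr /= !linearZl_LR /= !linearZr_LR /=.
have := form_cartan x a0; have := form_cartan y a0.
rewrite [form a y]formC; set c := cartan _ x a; set d := cartan _ y a.
move: (form_gt0 a0) => + h1 h2; nra.
Qed.

Lemma reflK a x : a != 0 -> refl form a (refl form a x) = x.
Proof.
move=> a0; rewrite reflE.
have -> : cartan form (refl form a x) a = - cartan form x a.
  have := refl_isometric a0 x a; rewrite refl_id // linearNr /= => h.
  by rewrite /cartan -[form _ a]opprK h mulrN mulNr.
by rewrite reflE scaleNr opprK subrK.
Qed.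

Lemma refl_compK a : a != 0 -> (refl form a \o refl form a = \1)%VF.
Proof. by move=> a0; apply/lfunP => x; rewrite comp_lfunE reflK // id_lfunE. Qed.

(** The conjugation formula g s_a g^-1 = s_(g a), stated without inverses. *)
Lemma isometric_comp_refl g a :
  isometric g -> (g \o refl form a = refl form (g a) \o g)%VF.
Proof.
move=> gI; apply/lfunP => x; rewrite !comp_lfunE !reflE /cartan !gI.
by rewrite linearB linearZ.
Qed.

Lemma refl_prod_cat s t :
  refl_prod form (s ++ t) = (refl_prod form s \o refl_prod form t)%VF.
Proof. by elim: s => [|a s IHs] /=; rewrite ?comp_lfun1l // IHs comp_lfunA. Qed.

(** Subtracting multiples of vectors orthogonal to [g] leaves the pairing with [g] unchanged, so the
    corrections simply add up. *)
Lemma refl_prod_orthogonal (gs : seq V) x :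
  pairwise (fun a b => form a b == 0) gs ->
  refl_prod form gs x = x - \sum_(g <- gs) cartan form x g *: g.
Proof.
elim: gs => [|g gs IHgs] /=; first by rewrite big_nil subr0 id_lfunE.
move=> /andP[/allP g_gs /IHgs{}IHgs]; rewrite comp_lfunE IHgs reflE big_cons.
suff -> : cartan form (x - \sum_(h <- gs) cartan form x h *: h) g = cartan form x g.
  by rewrite opprD addrA addrAC.
rewrite /cartan linearBl /= linear_sumlz big_seq big1 ?subr0 // => h /g_gs /eqP gh.
by rewrite linearZl_LR /= [form h g]formC gh mulr0.
Qed.

Lemma refl_group1 A : refl_group form A \1%VF.
Proof. by exists [::]. Qed.

Lemma refl_group_refl A a : a \in A -> refl_group form A (refl form a).
Proof.
by move=> aA; exists [:: a] => [x|] /=; [rewrite inE => /eqP->|rewrite comp_lfun1r].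
Qed.

Lemma refl_group_comp A g h :
  refl_group form A g -> refl_group form A h -> refl_group form A (g \o h)%VF.
Proof.
move=> [s sA ->] [t tA ->]; exists (s ++ t); last by rewrite refl_prod_cat.
by move=> x; rewrite mem_cat => /orP[/sA|/tA].
Qed.

Lemma refl_group_isometric A g :
  {in A, forall a, a != 0} -> refl_group form A g -> isometric g.
Proof.
move=> A0 [s sA ->]; elim: s sA => [|a s IHs] sA x y /=; first by rewrite !id_lfunE.
rewrite !comp_lfunE refl_isometric ?A0 ?sA ?mem_head // IHs // => z zs.
by rewrite sA // inE zs orbT.
Qed.

Lemma refl_group_inv A g :
  {in A, forall a, a != 0} -> refl_group form A g ->
  exists h, [/\ refl_group form A h, (h \o g = \1)%VF & (g \o h = \1)%VF].
Proof.
move=> A0 [s sA ->]; elim: s sA => [|a s IHs] sA /=.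
  by exists \1%VF; rewrite comp_lfun1l; split => //; exact: refl_group1.
have aA : a \in A by rewrite sA ?mem_head.
have [|h [hA hg gh]] := IHs; first by move=> z zs; rewrite sA // inE zs orbT.
exists (h \o refl form a)%VF; split.
- exact: refl_group_comp hA (refl_group_refl aA).
- by rewrite -comp_lfunA (comp_lfunA (refl _ _)) refl_compK ?A0 // comp_lfun1l.
- by rewrite comp_lfunA -(comp_lfunA (refl _ _)) gh comp_lfun1r refl_compK ?A0.
Qed.

Lemma refl_group_sub A B g :
  {subset A <= B} -> refl_group form A g -> refl_group form B g.
Proof. by move=> AB [s sA ->]; exists s => // x /sA/AB. Qed.

End DotProduct.

(** * Root systems and Weyl groups *)

Section RootSystem.

Variables (R : realFieldType) (V : vectType R) (form : {dot V for idfun}).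
Variables (Phi : seq V) (r : nat) (Delta : r.-tuple V).
Hypothesis Phi_root : is_root_system form Phi.
Hypothesis Delta_base : is_base Phi Delta.
Implicit Types (a b x y : V) (g w : 'End(V)) (J K : {set 'I_r}) (i j : 'I_r).
Implicit Type s : seq 'I_r.

Local Notation simple i := (tnth Delta i).
Local Notation word s := (refl_prod form [seq simple i | i <- s]).
Local Notation pos := (pos_root Phi Delta).
Local Notation co := (coord Delta).
Local Notation len := (coxlen form Delta).

Lemma neq0_root b : b \in Phi -> b != 0.
Proof. by move/(root_neq0 Phi_root). Qed.

Lemma root_opp b : b \in Phi -> - b \in Phi.
Proof. by move=> bP; rewrite -(refl_id form (neq0_root bP)) (root_refl Phi_root). Qed.

Lemma simple_root i : simple i \in Phi.
Proof. by apply: (base_sub Delta_base); exact: mem_tnth. Qed.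

Lemma neq0_simple i : simple i != 0.
Proof. exact: neq0_root (simple_root i). Qed.

Lemma coord_simple i j : co i (simple j) = (i == j)%:R.
Proof. by rewrite (tnth_nth 0) coord_free ?(base_free Delta_base) // eq_sym. Qed.

Lemma pos_root_coord b : pos b -> exists c : 'I_r -> nat, forall i, co i b = (c i)%:R.
Proof.
case=> _ [c ->]; exists c => i; rewrite linear_sum (bigD1 i) //= big1 => [|j ji].
  by rewrite linearMn /= coord_simple eqxx addr0.
by rewrite linearMn /= coord_simple eq_sym (negbTE ji) mul0rn.
Qed.

Lemma pos_root_coord_ge0 b i : pos b -> 0 <= co i b.
Proof. by case/pos_root_coord => c ->. Qed.

Lemma root_pos_or_neg b : b \in Phi -> pos b \/ pos (- b).
Proof. exact: base_pos_neg. Qed.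

Lemma pos_root_sum b : pos b -> b = \sum_i co i b *: simple i.
Proof.
move=> bpos; have [c cE] := pos_root_coord bpos; case: bpos => _ [d bE].
rewrite {1}bE; apply: eq_bigr => i _.
rewrite bE linear_sum (bigD1 i) //= big1 => [|j ji].
  by rewrite linearMn /= coord_simple eqxx addr0 scaler_nat.
by rewrite linearMn /= coord_simple eq_sym (negbTE ji) mul0rn.
Qed.

Lemma root_sum b : b \in Phi -> b = \sum_i co i b *: simple i.
Proof.
move=> /root_pos_or_neg[/pos_root_sum//|/pos_root_sum bE].
rewrite -{1}[b]opprK bE -sumrN; apply: eq_bigr => i _.
by rewrite linearN scaleNr opprK.
Qed.

Lemma pos_root_neq0 b : pos b -> exists i, 0 < co i b.
Proof.
move=> bpos; apply: contrapT => h; have := neq0_root bpos.1.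
rewrite (pos_root_sum bpos) big1 ?eqxx // => i _.
suff -> : co i b = 0 by rewrite scale0r.
apply/eqP; rewrite eq_le pos_root_coord_ge0 // andbT leNgt.
by apply/negP => bi; apply: h; exists i.
Qed.

Lemma pos_rootN b : pos b -> ~ pos (- b).
Proof.
move=> bpos bneg; have [i] := pos_root_neq0 bpos.
by have := pos_root_coord_ge0 i bneg; rewrite linearN /= oppr_ge0 => /le_gtF->.
Qed.

(** All coordinates of a root have the same weak sign, so one positive coordinate decides. *)
Lemma root_coord_gt0 b i : b \in Phi -> 0 < co i b -> pos b.
Proof.
move=> /root_pos_or_neg[//|/(pos_root_coord_ge0 i)].
by rewrite linearN /= oppr_ge0 => /le_gtF->.
Qed.

Lemma root_coord_ge0 b : b \in Phi -> (forall i, 0 <= co i b) -> pos b.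
Proof.
move=> /root_pos_or_neg[//|bneg] h; have [i] := pos_root_neq0 bneg.
by rewrite linearN /= oppr_gt0 => /(le_lt_trans (h i)); rewrite ltxx.
Qed.

Lemma form_root x b : b \in Phi -> form x b = \sum_i co i b * form x (simple i).
Proof.
move=> bP; rewrite {1}(root_sum bP) linear_sumr; apply: eq_bigr => i _.
by rewrite linearZr_LR.
Qed.

Lemma sumr_gt0_exists (F : 'I_r -> R) : 0 < \sum_i F i -> exists i, 0 < F i.
Proof.
move=> F0; apply: contrapT => h; move: F0; rewrite ltNge => /negP; apply.
by apply: sumr_le0 => i _; rewrite leNgt; apply/negP => Fi; apply: h; exists i.
Qed.

Lemma weyl_root w b : weyl form Phi w -> b \in Phi -> w b \in Phi.
Proof.
move=> [s sP ->] bP; elim: s sP => [|a s IHs] sP /=; first by rewrite id_lfunE.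
rewrite comp_lfunE; apply: (root_refl Phi_root); first exact/sP/mem_head.
by apply: IHs => z zs; rewrite sP // inE zs orbT.
Qed.

Lemma weyl_isometric w : weyl form Phi w -> isometric form w.
Proof. apply: refl_group_isometric => a; exact: neq0_root. Qed.

Lemma weyl_inv w : weyl form Phi w ->
  exists w', [/\ weyl form Phi w', (w' \o w = \1)%VF & (w \o w' = \1)%VF].
Proof. apply: refl_group_inv => a; exact: neq0_root. Qed.

Lemma inversionP w b :
  weyl form Phi w -> inversion Phi Delta w b <-> pos b /\ pos (- w b).
Proof.
move=> wW; split=> [[bpos [wbP nwb]]|[bpos wb]].
  by split=> //; case: (root_pos_or_neg wbP).
split=> //; split; first exact: weyl_root bpos.1.
by move=> /pos_rootN.
Qed.

Lemma coord_refl_simple x i j : j != i -> co j (refl form (simple i) x) = co j x.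
Proof.
by move=> ji; rewrite reflE linearB linearZ /= coord_simple (negbTE ji) mulr0 subr0.
Qed.

Lemma simple_pos i : pos (simple i).
Proof.
by apply: (root_coord_gt0 (i := i)); rewrite ?simple_root // coord_simple eqxx.
Qed.

(** A positive coordinate of [b] other than the [i]-th is untouched by the reflection. If there is
    none, [b] is a multiple of [simple i], and reducedness forces equality. *)
Lemma pos_refl_simple b i : pos b -> b != simple i -> pos (refl form (simple i) b).
Proof.
move=> bpos /eqP bi; have [[j [ji bj]]|h] := pselect (exists j, j != i /\ 0 < co j b).
  apply: (root_coord_gt0 (i := j)); last by rewrite coord_refl_simple.
  by rewrite (root_refl Phi_root) ?simple_root ?bpos.1.
have bE : b = co i b *: simple i.
  rewrite {1}(pos_root_sum bpos) (bigD1 i) //= big1 ?addr0 // => j ji.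
  suff -> : co j b = 0 by rewrite scale0r.
  apply/eqP; rewrite eq_le pos_root_coord_ge0 // andbT leNgt.
  by apply/negP => bj; apply: h; exists j.
have := bpos.1; rewrite bE => /(root_reduced Phi_root (simple_root i))[] k.
  by case: bi; rewrite bE k scale1r.
by have := pos_root_coord_ge0 i bpos; rewrite k oppr_ge0 ler10.
Qed.

Definition height x : R := \sum_i co i x.

Lemma heightB x y : height (x - y) = height x - height y.
Proof. by rewrite /height -sumrB; apply: eq_bigr => i _; rewrite linearB. Qed.

Lemma heightZ k x : height (k *: x) = k * height x.
Proof. by rewrite /height mulr_sumr; apply: eq_bigr => i _; rewrite linearZ. Qed.

Lemma height_gt0 b : pos b -> 0 < height b.
Proof.
move=> bpos; have [i bi] := pos_root_neq0 bpos.
rewrite /height (bigD1 i) //= ltr_pwDl // sumr_ge0 // => j _.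
exact: pos_root_coord_ge0.
Qed.

Lemma height_refl_lt a x : pos a -> 0 < form x a -> height (refl form a x) < height x.
Proof.
move=> apos xa; rewrite reflE heightB heightZ ltrBlDr ltrDl mulr_gt0 //.
  by rewrite cartan_gt0 ?neq0_root ?apos.1.
exact: height_gt0.
Qed.

Lemma neq0_simple_in K : {in simple_in Delta K, forall a, a != 0}.
Proof. by move=> _ /mapP[i _ ->]; exact: neq0_simple. Qed.

Lemma simple_inP K i : i \in K -> simple i \in simple_in Delta K.
Proof. by move=> iK; apply/mapP; exists i; rewrite ?mem_enum. Qed.

Lemma parabolic_srefl K i : i \in K -> parabolic form Delta K (srefl form Delta i).
Proof. by move=> iK; apply/refl_group_refl/simple_inP. Qed.

(** Induction on the height of a positive [b]. Since (b, b) > 0, some [simple i] occurring in [b]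
    pairs positively with it; then s_i b is lower and s_b is the conjugate of s_(s_i b) by s_i. *)
Lemma parabolic_refl K b : b \in Phi -> (forall i, i \notin K -> co i b = 0) ->
  parabolic form Delta K (refl form b).
Proof.
suff posK : {in Phi, forall b, pos b -> (forall i, i \notin K -> co i b = 0) ->
    parabolic form Delta K (refl form b)}.
  move=> bP bK; case: (root_pos_or_neg bP) => [|bneg]; first by move/posK; apply.
  rewrite -reflN; apply: posK (bneg) _ => [|i /bK]; first exact: root_opp.
  by rewrite linearN /= => ->; rewrite oppr0.
apply: (seq_lt_ind (f := height)) => {}b bP IH bpos bK.
have [|i] := sumr_gt0_exists (F := fun i => co i b * form b (simple i)).
  by rewrite -form_root // form_gt0 // neq0_root.
have := pos_root_coord_ge0 i bpos; rewrite le_eqVlt => /predU1P[<-|bi].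
  by rewrite mul0r ltxx.
rewrite pmulr_rgt0 // => b_i.
have iK : i \in K by apply: contraT => /bK h; rewrite h ltxx in bi.
have [->|bNi] := eqVneq b (simple i); first exact: parabolic_srefl.
have -> : refl form b = (srefl form Delta i \o
    (refl form (refl form (simple i) b) \o srefl form Delta i))%VF.
  rewrite /srefl -isometric_comp_refl; last exact/refl_isometric/neq0_simple.
  by rewrite comp_lfunA refl_compK ?neq0_simple // comp_lfun1l.
apply: refl_group_comp; first exact: parabolic_srefl.
apply: refl_group_comp; last exact: parabolic_srefl.
apply: IH; rewrite ?(root_refl Phi_root) ?simple_root //.
- by apply: height_refl_lt => //; exact: simple_pos.
- exact: pos_refl_simple.
- move=> j jK; rewrite coord_refl_simple ?bK //.
  by apply: contraNneq jK => ->.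
Qed.

Lemma weyl_parabolic w : weyl form Phi w -> parabolic form Delta [set: 'I_r] w.
Proof.
move=> [s sP ->]; elim: s sP => [|a s IHs] sP /=; first exact: refl_group1.
apply: refl_group_comp; last by apply: IHs => z zs; rewrite sP // inE zs orbT.
by apply: parabolic_refl => [|i]; [exact/sP/mem_head|rewrite inE].
Qed.

Lemma parabolic_weyl K g : parabolic form Delta K g -> weyl form Phi g.
Proof. by apply: refl_group_sub => _ /mapP[i _ ->]; exact: simple_root. Qed.

Lemma parabolicP K g : parabolic form Delta K g <->
  exists2 s, {subset s <= K} & g = word s.
Proof.
split=> [[t tK ->]|[s sK ->]]; last first.
  exists [seq simple i | i <- s] => // _ /mapP[i /sK iK ->]; exact: simple_inP.
elim: t tK => [|a t IHt] tK; first by exists [::].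
have [|s sK /= ->] := IHt; first by move=> z zt; rewrite tK // inE zt orbT.
have /mapP[i iK ->] := tK a (mem_head _ _); rewrite mem_enum in iK.
by exists (i :: s) => // j; rewrite inE => /predU1P[->//|/sK].
Qed.

(** Each generator of W_K changes only its own coordinate, whose index lies in [K]. *)
Lemma parabolic_coord K g i x :
  parabolic form Delta K g -> i \notin K -> co i (g x) = co i x.
Proof.
move=> /parabolicP[s sK ->] iK; elim: s sK => [|j s IHs] sK /=; first by rewrite id_lfunE.
rewrite comp_lfunE coord_refl_simple ?IHs // => [z zs|].
  by rewrite sK // inE zs orbT.
by apply: contraNneq iK => ->; rewrite sK ?mem_head.
Qed.

(** * Length and the exchange condition *)

Lemma coxlen_le_size s : (len (word s) <= size s)%N.
Proof.
have h : has_word form Delta (word s) (size s) by apply/existsP; exists (in_tuple s).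
rewrite /coxlen; case: pselect => [ex|[]]; last by exists (size s).
by case: ex_minnP => m _; apply.
Qed.

Lemma reduced_word w : weyl form Phi w -> exists2 s, w = word s & size s = len w.
Proof.
move=> /weyl_parabolic/parabolicP[s _ ->].
have h : has_word form Delta (word s) (size s) by apply/existsP; exists (in_tuple s).
rewrite /coxlen; case: pselect => [ex|[]]; last by exists (size s).
by case: ex_minnP => m /existsP[t /eqP <-] _; exists t; rewrite ?size_tuple.
Qed.

Lemma weyl_word s : weyl form Phi (word s).
Proof. by apply: (parabolic_weyl (K := [set: 'I_r])); apply/parabolicP; exists s. Qed.

(** The strong exchange condition: the letter whose reflection turns the image of [b] negative can
    be deleted. There the image of [b] under the remaining letters is [simple i], so by conjugation
    s_b moves to the left as s_i and cancels that letter. *)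
Lemma word_exchange s b : pos b -> pos (- word s b) ->
  exists2 t, (size t < size s)%N & (word s \o refl form b)%VF = word t.
Proof.
elim: s => [|i s IHs] bpos /=.
  by rewrite id_lfunE => /(pos_rootN bpos).
rewrite comp_lfunE => sb; have wbP := weyl_root (weyl_word s) bpos.1.
have [wb|wb] := root_pos_or_neg wbP; last first.
  by have [t lt_ts tE] := IHs bpos wb; exists (i :: t) => //=; rewrite -comp_lfunA tE.
have [wbi|wbi] := eqVneq (word s b) (simple i); last first.
  by case: (pos_rootN (pos_refl_simple wb wbi)).
exists s => //; rewrite -comp_lfunA isometric_comp_refl; last exact/weyl_isometric/weyl_word.
by rewrite wbi comp_lfunA refl_compK ?neq0_simple // comp_lfun1l.
Qed.

Lemma coxlen_refl_lt w b :
  weyl form Phi w -> pos b -> pos (- w b) -> (len (w \o refl form b)%VF < len w)%N.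
Proof.
move=> /reduced_word[s -> <-] bpos /(word_exchange bpos)[t lt_ts ->].
exact: leq_ltn_trans (coxlen_le_size t) lt_ts.
Qed.

Lemma coxlen_refl_gt w b :
  weyl form Phi w -> pos b -> pos (w b) -> (len w < len (w \o refl form b)%VF)%N.
Proof.
move=> wW bpos wb; have b0 := neq0_root bpos.1.
have tW : weyl form Phi (refl form b) by apply/refl_group_refl; exact: bpos.1.
have := coxlen_refl_lt (refl_group_comp wW tW) bpos.
rewrite -comp_lfunA refl_compK // comp_lfun1r; apply.
by rewrite comp_lfunE refl_id // linearN opprK.
Qed.

(** * Orthogonal stars *)

(* The two Cartan integers of [x] and [b] are negative, have product less than 4,
   and their ratio is the ratio of squared lengths, so they are determined by it. *)
Lemma same_length_form_eq i x y b :
    x \in Phi -> y \in Phi -> b \in Phi -> form x x = form y y ->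
    co i x != 0 -> co i y != 0 -> co i b = 0 ->
  form x b < 0 -> form y b < 0 -> form x b = form y b.
Proof.
move=> xP yP bP xy xi yi bi xb yb.
have b0 := form_gt0 form (neq0_root bP).
(* Strict Cauchy-Schwarz: [z] is not a multiple of [b], as only [z] involves [simple i]. The vector
   [t] is (b, b) times the component of [z] orthogonal to [b]. *)
have CS z : co i z != 0 -> form z b ^+ 2 < form z z * form b b.
  move=> zi; pose t := form b b *: z - form z b *: b.
  have /(form_gt0 form) : t != 0.
    apply: contra_neq zi => /(congr1 (co i)); rewrite linearB !linearZ /= bi mulr0 subr0.
    by rewrite linear0 => /eqP; rewrite mulf_eq0 gt_eqF //= => /eqP.
  rewrite /t !(linearBl, linearBr, linearZl_LR, linearZr_LR) /= [form b z]formC.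
  by nra.
have [m mE] := root_cartan Phi_root bP xP; have [n nE] := root_cartan Phi_root xP bP.
have [p pE] := root_cartan Phi_root bP yP; have [q qE] := root_cartan Phi_root yP bP.
have mx := form_cartan form x (neq0_root bP); have nx := form_cartan form b (neq0_root xP).
have py := form_cartan form y (neq0_root bP); have qy := form_cartan form b (neq0_root yP).
have x0 := form_gt0 form (neq0_root xP).
rewrite mE in mx; rewrite nE [form b x]formC in nx.
rewrite pE in py; rewrite qE [form b y]formC -xy in qy.
have := CS x xi; have := CS y yi; rewrite -xy => CSy CSx.
suff mp : m = p by have : 2 * form x b = 2 * form y b; [rewrite mx py mp|lra].
have h m' (n' : R) z : z < 0 -> 2 * z = m'%:~R * n' -> 0 < n' -> (m' < 0)%R.
  by move=> z0 zE n0; rewrite -(ltrz0 R); nra.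
apply: (@neg_int_ratio_inj m n p q).
- exact: h xb mx b0.
- exact: h xb nx x0.
- exact: h yb py b0.
- exact: h yb qy x0.
- by rewrite -(ltr_int R) intrM; nra.
- by rewrite -(ltr_int R) intrM; nra.
- by apply: (@intr_inj R); rewrite !intrM; nra.
Qed.

(** Otherwise the reflection of [simple i] in [simple j] would be a root with coordinates of both
    signs. *)
Lemma simple_obtuse i j : i != j -> form (simple i) (simple j) <= 0.
Proof.
move=> ij; rewrite leNgt -cartan_gt0 ?neq0_simple //; apply/negP => c0.
have bP : refl form (simple j) (simple i) \in Phi.
  by rewrite (root_refl Phi_root) ?simple_root.
have /(pos_root_coord_ge0 j) : pos (refl form (simple j) (simple i)).
  by apply: (root_coord_gt0 (i := i)) => //; rewrite coord_refl_simple // coord_simple eqxx.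
rewrite reflE linearB linearZ /= !coord_simple eqxx eq_sym (negbTE ij) mulr1 sub0r.
by rewrite oppr_ge0 leNgt c0.
Qed.

(** If [- b] were positive, it would be a nonnegative combination of simple roots other than
    [simple i], all of which pair nonpositively with [simple i]. *)
Lemma root_form_simple_lt0_pos i b :
  b \in Phi -> co i b = 0 -> form (simple i) b < 0 -> pos b.
Proof.
move=> bP bi; case: (root_pos_or_neg bP) => // bneg ib.
have : 0 < form (simple i) (- b) by rewrite linearNr /= oppr_gt0.
rewrite form_root ?bneg.1 // ltNge sumr_le0 // => j _.
have [->|ji] := eqVneq j i; first by rewrite linearN /= bi oppr0 mul0r.
by rewrite mulr_ge0_le0 ?pos_root_coord_ge0 // simple_obtuse // eq_sym.
Qed.

(* By Weyl-group invariance it suffices to move [x] one simple reflection closer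
   to [simple i] until a simple root separates them. *)
Lemma separating_root i : {in Phi, forall x, co i x = 1 ->
  form x x = form (simple i) (simple i) -> x != simple i ->
  exists b, [/\ b \in Phi, co i b = 0, 0 < form x b & form (simple i) b < 0]}.
Proof.
apply: (seq_lt_ind (f := height)) => x xP IH xi xx xNi.
have xpos : pos x by apply: (root_coord_gt0 (i := i)) => //; rewrite xi.
have x_i : form x (simple i) < form x x.
  have /(form_gt0 form) : x - simple i != 0 by rewrite subr_eq0.
  by rewrite !(linearBl, linearBr) /= [form (simple i) x]formC -xx => h; lra.
have [j [ji xj]] : exists j, j != i /\ 0 < form x (simple j).
  apply: contrapT => h; move: x_i; rewrite ltNge => /negP; apply.
  rewrite (form_root x xP) (bigD1 i) //= xi mul1r gerDl sumr_le0 // => j ji.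
  rewrite mulr_ge0_le0 ?pos_root_coord_ge0 // leNgt.
  by apply/negP => xj; apply: h; exists j.
(* If [simple j] is not orthogonal to [simple i], it separates them itself. Otherwise s_j fixes
   [simple i], and a root separating s_j x is carried back by s_j. *)
have := simple_obtuse ji; rewrite formC le_eqVlt => /predU1P[ij|ij]; last first.
  by exists (simple j); split; rewrite ?simple_root ?coord_simple // eq_sym (negbTE ji).
have sI := refl_isometric form (neq0_simple j).
have sK := reflK form _ (neq0_simple j).
have s_i : refl form (simple j) (simple i) = simple i.
  by rewrite reflE /cartan ij mulr0 mul0r scale0r subr0.
have [|||||y [yP yi xy y_i]] := IH (refl form (simple j) x).
- by rewrite (root_refl Phi_root) ?simple_root.
- by apply: height_refl_lt => //; exact: simple_pos.
- by rewrite coord_refl_simple // eq_sym.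
- by rewrite sI.
- by apply: contra_neq xNi => /(congr1 (refl form (simple j))); rewrite sK s_i.
exists (refl form (simple j) y); split.
- by rewrite (root_refl Phi_root) ?simple_root.
- by rewrite coord_refl_simple // eq_sym.
- by rewrite -sI sK.
- by rewrite -sI sK s_i.
Qed.

Definition orth_star i (gs : seq V) : Prop :=
  {in gs, forall g : V, [/\ g \in Phi, co i g = 0 & form (simple i) g < 0]} /\
  pairwise (fun a b => form a b == 0) gs.

(** For an orthogonal star the multiplicities [- cartan form (simple i) g] are positive integers. *)
Definition star_sum i (gs : seq V) : V :=
  simple i - \sum_(g <- gs) cartan form (simple i) g *: g.

Lemma orth_star_subseq i (gs hs : seq V) :
  subseq hs gs -> orth_star i gs -> orth_star i hs.
Proof.
move=> hg [gsP gs_orth]; split; last exact: subseq_pairwise gs_orth.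
by move=> g /(mem_subseq hg)/gsP.
Qed.

(** The sum is the image of [simple i] under the product of the reflections in [gs]. Applied to
    subsequences, this makes every partial sum a root. *)
Lemma star_sum_root i (gs : seq V) : orth_star i gs ->
  [/\ star_sum i gs \in Phi, co i (star_sum i gs) = 1
    & form (star_sum i gs) (star_sum i gs) = form (simple i) (simple i)].
Proof.
move=> [gsP gs_orth]; have sE := refl_prod_orthogonal (simple i) gs_orth.
have sW : weyl form Phi (refl_prod form gs) by exists gs => // g /gsP[].
split; last by rewrite /star_sum -sE (weyl_isometric sW).
  by rewrite /star_sum -sE weyl_root ?simple_root.
rewrite /star_sum linearB linear_sum /= coord_simple eqxx big_seq big1 ?subr0 // => g.
by case/gsP=> _ gi _; rewrite linearZ /= gi mulr0.
Qed.

(** Induction on height: reflecting [x] in a separating root [g] lowers it, and the star [gs] of the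
    reflected root turns out to be orthogonal to [g], so [g :: gs] is a star for [x]. *)
Lemma orth_star_exists i : {in Phi, forall x, co i x = 1 ->
  form x x = form (simple i) (simple i) ->
  exists2 gs, orth_star i gs & x = star_sum i gs}.
Proof.
have ii : co i (simple i) != 0 by rewrite coord_simple eqxx oner_neq0.
apply: (seq_lt_ind (f := height)) => x xP IH xi xx.
have [->|/(separating_root xP xi xx)[g [gP gi xg ig]]] := eqVneq x (simple i).
  by exists [::] => //; rewrite /star_sum big_nil subr0.
have g0 := neq0_root gP; have gpos := root_form_simple_lt0_pos gP gi ig.
(* Both [- x] and [simple i] pair negatively with [g], and they have the same length. *)
have xgE : form x g = - form (simple i) g.
  rewrite -[form x g]opprK -linearNl; congr (- _).
  apply: (same_length_form_eq (i := i)); rewrite ?root_opp ?simple_root //.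
  - by rewrite linearNl /= linearNr opprK.
  - by rewrite linearN /= xi oppr_eq0 oner_neq0.
  - by rewrite linearNl oppr_lt0.
have cE : cartan form x g = - cartan form (simple i) g by rewrite /cartan xgE mulrN mulNr.
have [||||gs gsS yE] := IH (refl form g x).
- exact: (root_refl Phi_root).
- exact: height_refl_lt.
- by rewrite reflE linearB linearZ /= gi mulr0 subr0.
- by rewrite refl_isometric.
(* Pair [yE] with [g]: the reflected root has pairing - (x, g), which by [xgE] is that of
   [simple i]. *)
have gs_orth : \sum_(h <- gs) cartan form (simple i) h * form h g = 0.
  have := congr1 (form^~ g) yE; rewrite /star_sum reflE !linearBl linearZl_LR linear_sumlz /=.
  under eq_bigr do rewrite linearZl_LR /=.
  have := form_cartan form x g0; lra.
have gs_ge0 : {in gs, forall h, 0 <= form h g}.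
  (* Otherwise the partial sum over the [h] with [form h g < 0] pairs with [g]
     more negatively than [simple i], although both have the same length. *)
  move=> h hgs; rewrite leNgt; apply/negP => hg.
  pose hs := [seq h <- gs | form h g < 0].
  have hsS : orth_star i hs := orth_star_subseq (filter_subseq _ _) gsS.
  have [sP si ss] := star_sum_root hsS.
  have sg : form (star_sum i hs) g < form (simple i) g.
    rewrite /star_sum linearBl /= linear_sumlz ltrBlDr ltrDl.
    have F0 h' : h' \in hs -> 0 < form (cartan form (simple i) h' *: h') g.
      rewrite mem_filter => /andP[hg' /gsS.1[hP _ ih]].
      by rewrite linearZl_LR /= nmulr_rgt0 // cartan_lt0 // neq0_root.
    have hhs : h \in hs by rewrite mem_filter hg.
    rewrite (perm_big _ (perm_to_rem hhs)) big_cons ltr_pwDl ?F0 //.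
    by rewrite big_seq sumr_ge0 // => h' /mem_rem/F0/ltW.
  have := same_length_form_eq (i := i) sP (simple_root i) gP ss.
  rewrite si oner_neq0 ii gi => /(_ isT isT erefl (lt_trans sg ig) ig) sgE.
  by rewrite sgE ltxx in sg.
(* The sum in [gs_orth] has only nonpositive terms, so each is zero, and the Cartan factors are
   negative. *)
have gs_eq0 : {in gs, forall h, form g h = 0}.
  move: gs_orth => /eqP; rewrite big_seq -oppr_eq0 -sumrN psumr_eq0 => [/allP gs0 h hgs|h hgs].
    have := gs0 h hgs; rewrite hgs oppr_eq0 mulf_eq0 formC /= => /orP[|/eqP//].
    have [hP _] := gsS.1 h hgs.
    by rewrite -cartan_lt0 ?neq0_root // => /lt_eqF->.
  have [hP _ ih] := gsS.1 h hgs.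
  by rewrite oppr_ge0 mulr_le0_ge0 ?gs_ge0 // ltW // cartan_lt0 ?neq0_root.
exists (g :: gs).
  split=> [h|]; last by rewrite /= gsS.2 andbT; apply/allP => h /gs_eq0 ->.
  by rewrite inE => /predU1P[->//|/gsS.1].
move: yE; rewrite /star_sum reflE big_cons cE scaleNr opprK => yE.
by rewrite opprD addrCA -yE [- _ + _]addrC addrK.
Qed.

(** * Parabolic subgroups and Bruhat order *)

Lemma pos_root_inP J b :
  pos_root_in Phi Delta J b <-> pos b /\ forall i, i \notin J -> co i b = 0.
Proof.
split=> [[bpos bJ]|[bpos bJ]]; split=> //; last first.
  rewrite (pos_root_sum bpos) memv_suml // => i _.
  have [iJ|/bJ->] := boolP (i \in J); last by rewrite scale0r mem0v.
  exact/memvZ/memv_span/simple_inP.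
move=> i iJ; suff /subvP/(_ _ bJ) : (<<simple_in Delta J>> <= lker (linfun (co i : V -> R^o)))%VS.
  by rewrite memv_ker lfunE => /eqP.
apply/span_subvP => _ /mapP[j jJ ->]; rewrite memv_ker lfunE /= coord_simple.
by have [ij|//] := eqVneq i j; rewrite ij -mem_enum jJ in iJ.
Qed.

Lemma not_pos_root_in J b :
  pos b -> ~ pos_root_in Phi Delta J b <-> exists2 i, i \notin J & 0 < co i b.
Proof.
move=> bpos; rewrite pos_root_inP; split=> [nb|[i iJ bi] [_ /(_ i iJ) b0]]; last first.
  by rewrite b0 ltxx in bi.
apply: contrapT => h; apply: nb; split=> // i iJ; apply/eqP.
rewrite eq_le pos_root_coord_ge0 // andbT leNgt; apply/negP => bi.
by apply: h; exists i.
Qed.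

(** A positive coordinate outside [J] is preserved by [u]. *)
Lemma parabolic_pos_root J u b : parabolic form Delta J u ->
  pos b -> ~ pos_root_in Phi Delta J b -> pos (u b) /\ ~ pos_root_in Phi Delta J (u b).
Proof.
move=> uJ bpos /(not_pos_root_in J bpos)[i iJ bi].
have ui : 0 < co i (u b) by rewrite (parabolic_coord _ uJ).
have upos : pos (u b).
  by apply: root_coord_gt0 ui; apply: weyl_root bpos.1; exact: parabolic_weyl uJ.
by split=> //; apply/not_pos_root_in => //; exists i.
Qed.

Lemma min_coset_rep_pos J v i : min_coset_rep form Phi Delta J v -> i \in J ->
  pos (v (simple i)).
Proof.
move=> [vW vmin] iJ; have [//|vi] := root_pos_or_neg (weyl_root vW (simple_root i)).
have := vmin _ (parabolic_srefl iJ).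
by rewrite leqNgt coxlen_refl_lt //; exact: simple_pos.
Qed.

Lemma pos_on_span J v b : weyl form Phi v -> {in J, forall i, pos (v (simple i))} ->
  pos_root_in Phi Delta J b -> pos (v b).
Proof.
move=> vW vJ /pos_root_inP[bpos bJ].
apply: root_coord_ge0 => [|l]; first exact: weyl_root bpos.1.
rewrite (pos_root_sum bpos) !linear_sum /= sumr_ge0 // => i _.
rewrite !linearZ /=; have [iJ|/bJ->] := boolP (i \in J); last by rewrite mul0r.
by rewrite mulr_ge0 ?pos_root_coord_ge0 //; exact: vJ.
Qed.

(** Minimize the length over the coset w W_K; [y] is then the inverse of the parabolic factor
    w_K. *)
Lemma coset_rep_exists K w : weyl form Phi w ->
  exists2 y, parabolic form Delta K y & min_coset_rep form Phi Delta K (w \o y)%VF.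
Proof.
move=> wW; pose P n := `[< exists2 y, parabolic form Delta K y & len (w \o y)%VF = n >].
have exP : exists n, P n.
  by exists (len (w \o \1)%VF); apply/asboolP; exists \1%VF => //; exact: refl_group1.
case: (ex_minnP exP) => n /asboolP[y yK <-] ymin; exists y => //.
split=> [|u uK]; first exact: refl_group_comp wW (parabolic_weyl yK).
apply: ymin; apply/asboolP; exists (y \o u)%VF; first exact: refl_group_comp.
by rewrite comp_lfunA.
Qed.

(** If a reduced word of [w] ended in [i], then w s_i would be shorter than [w], yet positivity of
    [w (simple i)] makes it longer. *)
Lemma weyl_pos_eq1 w : weyl form Phi w -> (forall i, pos (w (simple i))) -> w = \1%VF.
Proof.
move=> wW wpos; have [s wE] := reduced_word wW.
case: (lastP s) wE => // {}s i; rewrite map_rcons -cats1 refl_prod_cat /= comp_lfun1r => wE.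
rewrite size_rcons => slen; have := coxlen_refl_gt wW (simple_pos i) (wpos i).
rewrite {2}wE -comp_lfunA refl_compK ?neq0_simple // comp_lfun1r -slen.
by move=> /leq_trans/(_ (coxlen_le_size s)); rewrite ltnNge leqnSn.
Qed.

(** Take [y] in the parabolic with [v \o y] minimal in its coset. This product keeps the other
    simple roots positive by minimality and [simple i] by hypothesis, so it is the identity. *)
Lemma parabolic_of_orbit_pos i v : weyl form Phi v ->
  (forall y : 'End(V), parabolic form Delta [set~ i] y -> pos (v (y (simple i)))) ->
  parabolic form Delta [set~ i] v.
Proof.
move=> vW vpos; have [y yK vy] := coset_rep_exists [set~ i] vW.
have [h [hK _ yh]] := refl_group_inv (@neq0_simple_in _) yK.
suff vy1 : (v \o y = \1)%VF by rewrite -[v]comp_lfun1r -yh comp_lfunA vy1 comp_lfun1l.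
apply: weyl_pos_eq1 vy.1 _ => j; have [->|ji] := eqVneq j i.
  by rewrite comp_lfunE; exact: vpos.
by apply: min_coset_rep_pos vy _; rewrite !inE.
Qed.

(** In one step x = y s_b with [b] positive, the drop in length makes [y] negate [b]. As [y]
    preserves the coordinates outside [K], those of [b] vanish, and s_b lies in W_K. *)
Lemma bruhat_le_parabolic K (x y : 'End(V)) :
  bruhat_le form Phi Delta x y -> parabolic form Delta K y -> parabolic form Delta K x.
Proof.
elim=> {x y} [x y [b bP [yE lt_xy]] yK|//|x y z _ IHxy _ IHyz /IHyz/IHxy//].
have b0 := neq0_root bP.
have xE : x = (y \o refl form b)%VF by rewrite yE -comp_lfunA refl_compK // comp_lfun1r.
wlog bpos : b bP yE b0 xE / pos b.
  move=> wl; have [|bneg] := root_pos_or_neg bP; first exact: wl.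
  by apply: (wl (- b)); rewrite ?root_opp ?oppr_eq0 ?reflN.
have yW := parabolic_weyl yK.
have [yb|yb] := root_pos_or_neg (weyl_root yW bP).
  by have := coxlen_refl_gt yW bpos yb; rewrite -xE ltnNge ltnW.
rewrite xE; apply: (refl_group_comp yK); apply: parabolic_refl => // i iK.
apply/eqP; rewrite eq_le (pos_root_coord_ge0 i bpos) andbT.
by have := pos_root_coord_ge0 i yb; rewrite linearN /= (parabolic_coord _ yK) // oppr_ge0.
Qed.

Lemma in_supp_not_parabolic v i :
  in_supp form Phi Delta v i -> ~ parabolic form Delta [set~ i] v.
Proof.
move=> vi /(bruhat_le_parabolic vi) sK.
have := parabolic_coord (simple i) sK (i := i); rewrite !inE eqxx => /(_ isT).
rewrite /srefl refl_id ?neq0_simple // linearN /= coord_simple eqxx => /eqP.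
by rewrite -subr_eq0 -opprD oppr_eq0 -mulr2n pnatr_eq0.
Qed.

(** * Reduced words, support and left descents *)

Definition reduced s : Prop := len (word s) = size s.

Lemma word_cat s t : word (s ++ t) = (word s \o word t)%VF.
Proof. by rewrite map_cat refl_prod_cat. Qed.

Lemma reduced_cat s t : reduced (s ++ t) -> reduced s /\ reduced t.
Proof.
rewrite /reduced size_cat; have [s' sE s'l] := reduced_word (weyl_word s).
have [t' tE t'l] := reduced_word (weyl_word t).
have := coxlen_le_size s; have := coxlen_le_size t; have := coxlen_le_size (s' ++ t').
rewrite !word_cat size_cat -sE -tE; lia.
Qed.

Lemma bruhat_le_prefix s t :
  reduced (s ++ t) -> bruhat_le form Phi Delta (word s) (word (s ++ t)).
Proof.
elim/last_ind: t => [|t i IHt]; first by rewrite cats0 => _; exact: rt_refl.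
rewrite -rcons_cat -cats1 => sti; have [st _] := reduced_cat sti.
apply: rt_trans (IHt st) (rt_step _ _ _ _ _); exists (simple i); first exact: simple_root.
by rewrite sti st [size (_ ++ [:: i])]size_cat addn1 ltnS leqnn word_cat /= comp_lfun1r.
Qed.

Lemma bruhat_le_suffix s t :
  reduced (s ++ t) -> bruhat_le form Phi Delta (word t) (word (s ++ t)).
Proof.
elim: s => [|i s IHs] /=; first by move=> _; exact: rt_refl.
rewrite -cat1s => ist; have [_ st] := reduced_cat ist.
apply: rt_trans (IHs st) (rt_step _ _ _ _ _).
have [h [hW _ sh]] := weyl_inv (weyl_word (s ++ t)).
(* A Bruhat step multiplies by a reflection on the right, so s_i on the left is conjugated across
   the word. *)
exists (h (simple i)); first exact/weyl_root/simple_root.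
rewrite ist st /=; split=> //.
rewrite isometric_comp_refl; last exact/weyl_isometric/weyl_word.
by rewrite -[word (s ++ t) (h _)]comp_lfunE sh id_lfunE.
Qed.

(** If [i] occurs in a reduced word of [v], then s_i is a prefix of a suffix of that word, hence
    below [v]. *)
Lemma not_in_supp_parabolic v i : weyl form Phi v ->
  ~ in_supp form Phi Delta v i -> parabolic form Delta [set~ i] v.
Proof.
move=> /reduced_word[s -> slen] vi; apply/parabolicP; exists s => // j js.
rewrite !inE; apply/eqP => ji; apply: vi; rewrite -ji /in_supp.
case/splitPr: js slen => s1 s2; rewrite -cat1s => /esym s12.
have [_ js2] := reduced_cat s12.
apply: rt_trans (bruhat_le_suffix s12); have := bruhat_le_prefix js2.
by rewrite [word [:: j]]comp_lfun1r.
Qed.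

(** With [u'] the inverse of [u], s_i u is [u] times the reflection in [u' (simple i)], whose sign
    decides the change of length. *)
Lemma left_descentP u u' i : weyl form Phi u -> weyl form Phi u' -> (u \o u' = \1)%VF ->
  i \in left_descent form Delta u <-> pos (- u' (simple i)).
Proof.
move=> uW u'W uu'; pose b := u' (simple i).
have ub : u b = simple i by rewrite -comp_lfunE uu' id_lfunE.
have sE : (srefl form Delta i \o u = u \o refl form b)%VF.
  by rewrite isometric_comp_refl ?ub //; exact: weyl_isometric.
rewrite inE sE; split=> [lt_u|bneg].
  have [bpos|//] := root_pos_or_neg (weyl_root u'W (simple_root i)).
  have := coxlen_refl_gt uW bpos; rewrite -/b ub => /(_ (simple_pos i)).
  by rewrite ltnNge ltnW.
have uNb : - u (- b) = simple i by rewrite linearN /= ub opprK.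
rewrite -reflN; apply: coxlen_refl_lt => //; rewrite uNb.
exact: simple_pos.
Qed.

(** * Billey--Postnikov decompositions and stars *)

(* Taking a root of minimal height among those negated by [v] forces [v] to
   negate every summand [g]: otherwise [g] could be dropped. *)
Lemma negated_star_exists v i : weyl form Phi v -> {in Phi, forall x, co i x = 1 ->
  form x x = form (simple i) (simple i) -> pos (- v x) ->
  exists gs, [/\ orth_star i gs, {in gs, forall b, pos (- v b)}
    & pos (- v (star_sum i gs))]}.
Proof.
move=> vW; apply: (seq_lt_ind (f := height)) => x xP IH xi xx vx.
have [gs gsS xE] := orth_star_exists xP xi xx.
have [h|h] := pselect {in gs, forall b, pos (- v b)}.
  by exists gs; split=> //; rewrite -xE.
have [b [bgs vb]] : exists b, b \in gs /\ ~ pos (- v b).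
  by apply: contrapT => h'; apply: h => b bgs; apply: contrapT => vb; apply: h'; exists b.
have [bP bi ib] := gsS.1 b bgs.
have {}vb : pos (v b) by case: (root_pos_or_neg (weyl_root vW bP)).
have c0 : cartan form (simple i) b < 0 by rewrite cartan_lt0 ?neq0_root.
have [yP yi yy] := star_sum_root (orth_star_subseq (rem_subseq b gs) gsS).
have {}xE : x = star_sum i (rem b gs) - cartan form (simple i) b *: b.
  by rewrite xE /star_sum (perm_big _ (perm_to_rem bgs)) big_cons opprD addrA addrAC.
apply: (IH _ yP _ yi yy).
  rewrite xE heightB heightZ ltrDl oppr_gt0 nmulr_rlt0 //.
  exact/height_gt0/(root_form_simple_lt0_pos bP bi ib).
have [vy|//] := root_pos_or_neg (weyl_root vW yP).
case/pos_rootN: vx; rewrite opprK; apply: root_coord_ge0 => [|l].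
  exact: weyl_root.
move: (star_sum i (rem b gs)) vy xE => y vy ->.
rewrite !linearB !linearZ /= subr_ge0 (le_trans (y := 0)) ?pos_root_coord_ge0 //.
by rewrite nmulr_rle0 ?pos_root_coord_ge0.
Qed.

Lemma BP_avoids_stars w J : BP form Phi Delta J w -> avoids_stars Phi Delta J w.
Proof.
move=> [v [u [vmin uJ -> vuJ]]] b k c g [[_ bJ gJ _ sumP] ninv inv].
have vW := vmin.1; have uW := parabolic_weyl uJ.
have wW : weyl form Phi (v \o u)%VF by exact: refl_group_comp.
have [u' [u'W u'u uu']] := weyl_inv uW.
have [bpos b0] := (pos_root_inP J b).1 bJ.
move: inv ninv; rewrite !inversionP // !comp_lfunE => -[_ wneg] ninv.
have ub0 i : i \notin J -> co i (u b) = 0 by move=> iJ; rewrite (parabolic_coord _ uJ) ?b0.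
have ubpos : pos (u b).
  (* Were [u b] negative, [v] would keep its opposite, a positive root of Phi_J, positive, and [b]
     would be an inversion. *)
  have [//|ubneg] := root_pos_or_neg (weyl_root uW bpos.1).
  case: ninv; split=> //; rewrite -linearN; apply: (pos_on_span (J := J)) => //.
    by move=> i; exact: min_coset_rep_pos.
  by apply/pos_root_inP; split=> // i /ub0; rewrite linearN /= => ->; rewrite oppr0.
have [i [iJ ubi vi]] : exists i, [/\ i \in J, 0 < co i (u b) & ~ in_supp form Phi Delta v i].
  (* Otherwise every simple root occurring in [u b] is negated by [u'], so [b = u' (u b)] would be
     negative. *)
  apply: contrapT => h; apply: (pos_rootN bpos).
  apply: root_coord_ge0 => [|l]; first exact: root_opp bpos.1.
  have bE : b = u' (u b) by rewrite -comp_lfunE u'u id_lfunE.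
  rewrite bE (pos_root_sum ubpos) linear_sum -sumrN linear_sum sumr_ge0 //= => i _.
  have [iJ|/ub0->] := boolP (i \in J); last by rewrite scale0r linear0 oppr0 linear0.
  have := pos_root_coord_ge0 i ubpos; rewrite le_eqVlt => /predU1P[<-|ubi].
    by rewrite scale0r linear0 oppr0 linear0.
  have vi : in_supp form Phi Delta v i by apply: contrapT => vi; apply: h; exists i.
  have /(left_descentP i uW u'W uu') := vuJ i vi iJ => /(pos_root_coord_ge0 l).
  by rewrite linearZ /= !linearN linearZ /= => h1; rewrite -mulrN mulr_ge0 // ltW.
(* Compare coordinate [i], which [v] preserves: [u b] contributes a positive amount, and each
   [u (g l)] is positive because [g l] lies outside Phi_J. *)
have := pos_root_coord_ge0 i wneg; rewrite linearN /= oppr_ge0.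
rewrite (parabolic_coord _ (not_in_supp_parabolic vW vi)) ?inE ?eqxx //.
rewrite linearD linear_sum linearD linear_sum /= leNgt ltr_pwDl // sumr_ge0 // => l _.
have [gpos /(parabolic_pos_root uJ gpos)[ugpos _]] := gJ l.
by rewrite !linearMn /= mulrn_wge0 // pos_root_coord_ge0.
Qed.

Lemma avoids_stars_BP w J :
  weyl form Phi w -> avoids_stars Phi Delta J w -> BP form Phi Delta J w.
Proof.
move=> wW wavoid; have [y yJ vmin] := coset_rep_exists J wW.
have [u [uJ uy yu]] := refl_group_inv (@neq0_simple_in _) yJ.
have yW := parabolic_weyl yJ; have uW := parabolic_weyl uJ; have vW := vmin.1.
exists (w \o y)%VF, u; split=> // [|i vi iJ]; first by rewrite -comp_lfunA yu comp_lfun1r.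
apply/(left_descentP i uW yW uy); apply: contrapT => yi.
have {yi}ypos : pos (y (simple i)).
  by case: (root_pos_or_neg (weyl_root yW (simple_root i))).
set v := (w \o y)%VF in vi vmin vW *.
have vJ : {in J, forall j, pos (v (simple j))} by move=> j; exact: min_coset_rep_pos.
have [x [xK vx]] : exists x : 'End(V), parabolic form Delta [set~ i] x /\ pos (- v (x (simple i))).
  apply: contrapT => h; apply: (in_supp_not_parabolic vi).
  apply: parabolic_of_orbit_pos => // x xK.
  have xW := parabolic_weyl xK.
  have [//|vx] := root_pos_or_neg (weyl_root vW (weyl_root xW (simple_root i))).
  by case: h; exists x.
have xW := parabolic_weyl xK.
have [||||gs [gsS vgs vsum]] := @negated_star_exists v i vW (x (simple i)).
- exact/weyl_root/simple_root.
- by rewrite (parabolic_coord _ xK) ?coord_simple ?inE ?eqxx.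
- by rewrite (weyl_isometric xW).
- exact: vx.
(* The star of [v] is carried along [y], the inverse of [u]; since [w (y x) = v x], signs under [w]
   are those under [v]. *)
pose g (l : 'I_(size gs)) := y gs`_l.
have gsl (l : 'I_(size gs)) : gs`_l \in gs by exact: mem_nth.
have cP l : exists n : nat, (0 < n)%N /\ n%:R = - cartan form (simple i) gs`_(l : 'I_(size gs)).
  have [gP _ ig] := gsS.1 _ (gsl l).
  have [z zE] := root_cartan Phi_root gP (simple_root i).
  have : cartan form (simple i) gs`_l < 0 by rewrite cartan_lt0 ?neq0_root.
  rewrite zE ltrz0 => z0; exists `|z|%N; split; first by lia.
  by rewrite pmulrn -mulrNz; congr (_%:~R); lia.
have {cP}[c cP] := fin_all_exists cP.
have gpos l : pos (g l) /\ ~ pos_root_in Phi Delta J (g l).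
  have [gP gi ig] := gsS.1 _ (gsl l).
  apply: parabolic_pos_root yJ (root_form_simple_lt0_pos gP gi ig) _ => gJ.
  exact: pos_rootN (pos_on_span vW vJ gJ) (vgs _ (gsl l)).
have sumE (I : {set 'I_(size gs)}) : y (simple i) + \sum_(l in I) g l *+ c l =
    y (star_sum i [seq gs`_l | l : 'I_(size gs) <- enum I]).
  rewrite /star_sum big_map big_enum /= linearB linear_sum -sumrN; congr (_ + _).
  by apply: eq_bigr => l _; rewrite -scaler_nat (cP l).2 linearZ scaleNr.
have gsE : gs = [seq gs`_l | l : 'I_(size gs) <- enum 'I_(size gs)].
  by rewrite (map_comp (nth 0 gs) val) val_enum_ord map_nth_iota0 ?take_size.
(* Positivity holds coordinatewise; the sum is a root because index subsets give subsequences of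
   [gs], hence smaller orthogonal stars. *)
have sumP (I : {set 'I_(size gs)}) : pos (y (simple i) + \sum_(l in I) g l *+ c l).
  apply: root_coord_ge0 => [|j]; last first.
    rewrite linearD linear_sum addr_ge0 ?pos_root_coord_ge0 // sumr_ge0 // => l _.
    by rewrite linearMn mulrn_wge0 // pos_root_coord_ge0 //; exact: (gpos l).1.
  rewrite sumE; apply: weyl_root yW _.
  suff /orth_star_subseq/(_ gsS)/star_sum_root[] :
      subseq [seq gs`_l | l : 'I_(size gs) <- enum I] gs by [].
  by rewrite [X in subseq _ X]gsE map_subseq // enumT /enum_mem filter_subseq.
have sumT : \sum_(l < size gs) g l *+ c l = \sum_(l in [set: 'I_(size gs)]) g l *+ c l.
  by apply: eq_bigl => l; rewrite inE.
apply: (wavoid (y (simple i)) (size gs) c g); split; last 1 first.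
- apply/inversionP => //; rewrite sumT; split=> //.
  by rewrite sumE enum_setT -enumT -gsE -[w _]comp_lfunE.
- split=> // [||l]; last exact: (cP l).1.
    (* An empty star would have sum [simple i], which [v] keeps positive. *)
    case: (gs) vsum => // h; case: (pos_rootN (vJ i iJ)).
    by move: h; rewrite /star_sum big_nil subr0.
  apply/pos_root_inP; split=> // l lJ; rewrite (parabolic_coord _ yJ) // coord_simple.
  by case: eqP => // li; rewrite li iJ in lJ.
- move=> /(inversionP _ wW)[_]; rewrite -comp_lfunE.
  exact/pos_rootN/vJ.
Qed.

End RootSystem.

Theorem theorem1p1 (R : realFieldType) (V : vectType R)
    (form : {dot V for idfun}) (Phi : seq V) (r : nat) (Delta : r.-tuple V)
    (Phi_root_system : is_root_system form Phi)
    (Delta_base : is_base Phi Delta)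
    (w : 'End(V)) (w_weyl : weyl form Phi w) (J : {set 'I_r}) :
  BP form Phi Delta J w <-> avoids_stars Phi Delta J w.
Proof.
by split; [exact: BP_avoids_stars|exact: avoids_stars_BP].
Qed.
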